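(* There exists a nonempty strongly one-sided dense $F_\sigma$ set $F\subset\mathbb{R}$ which does not contain any nonempty, closed, strongly one-sided dense subset.
   Context: Let $|A|$ denote the Lebesgue measure of $A$. A set $E\subset\mathbb{R}$ is strongly one-sided dense at $x$ if for every sequence of positive numbers $r_n\to 0^+$ we have $$\max\Big\{\frac{|E\cap[x-r_n,x]|}{r_n},\frac{|E\cap[x,x+r_n]|}{r_n}\Big\}\to 1.$$ The set $E$ is strongly one-sided dense (SOSD) if it is strongly one-sided dense at every point $x\in E$. *)

(* Defs.v *)
From mathcomp Require Import all_boot all_order all_algebra.
From mathcomp Require Import all_classical all_reals all_analysis.

Set Implicit Arguments.
Unset Strict Implicit.
Unset Printing Implicit Defensive.

Import Order.TTheory GRing.Theory Num.Theory.
Import numFieldNormedType.Exports.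

Local Open Scope classical_set_scope.
Local Open Scope ring_scope.

(* Taking [fine] loses nothing in [SOSD_at]: the measured sets lie in bounded
   intervals, so their measure is finite. *)
Definition measR (R : realType) (A : set R) : R := fine (lebesgue_measure A).

Definition SOSD_at (R : realType) (E : set R) (x : R) : Prop :=
  forall r : R^nat, (forall n, 0 < r n) -> r n @[n --> \oo] --> (0 : R) ->
    Num.max (measR (E `&` `[x - r n, x]) / r n)
            (measR (E `&` `[x, x + r n]) / r n) @[n --> \oo] --> (1 : R).

Definition SOSD (R : realType) (E : set R) : Prop :=
  forall x, E x -> SOSD_at E x.

(* Main.v *)
(* F is the complement of a null G_delta set, so it has density 1 everywhere.
   Let W_n be a union, over intervals ]a, a + L[ with a rational and 1/L a
   positive integer, of very late stages of the Cantor construction that keeps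
   the two outer quarters; W_n is open, decreasing in n, of measure at most
   2^-n, and F is the complement of the intersection of the W_n.

   Two gaps of length l of a closed set K whose distance is at most 2 l force
   both one-sided densities at scale 3 l to be at most 2/3 at every point of K
   lying between them.  If K misses a Cantor stage in ]a, a + L[ and has no such
   pairs of gaps there, the gaps merge, quarter by quarter, until K misses the
   whole interval.  So near every point of K there are points of W_n or of K
   between two such gaps of length below 1/n.  By Baire's theorem in K some
   point of K has this property for all n; as it lies in F, it leaves W_n for
   large n, hence K is not SOSD there. *)
Require Import Defs.
From mathcomp Require Import all_boot all_order all_algebra.
From mathcomp Require Import all_classical all_reals all_analysis borel_hierarchy.
From mathcomp Require Import measurable_realfun lra.
Set Implicit Arguments.
Unset Strict Implicit.
Unset Printing Implicit Defensive.

Import Order.TTheory GRing.Theory Num.Theory.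
Import numFieldNormedType.Exports.
Local Open Scope classical_set_scope.
Local Open Scope ring_scope.

(** * Stages of the Cantor construction *)

Fixpoint cantor_stage (R : realType) (j : nat) (a L : R) : set R :=
  if j is i.+1 then
    cantor_stage i a (L / 4) `|` cantor_stage i (a + L * 3 / 4) (L / 4)
  else `]a, a + L[.

Lemma cantor_stage_open (R : realType) j (a L : R) : open (cantor_stage j a L).
Proof.
elim: j a L => [|j IH] a L /=; first exact: interval_open.
exact: openU.
Qed.

Lemma cantor_stageS (R : realType) j (a L : R) : 0 < L ->
  cantor_stage j.+1 a L `<=` cantor_stage j a L.
Proof.
elim: j a L => [|j IH] a L L0 x.
  by rewrite /= !in_itv/= => -[] /andP[? ?]; apply/andP; split; lra.
have L4 : 0 < L / 4 by lra.
by case=> /(IH _ _ L4) ?; [left|right].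
Qed.

Lemma cantor_stage_antitone (R : realType) i j (a L : R) : 0 < L -> (i <= j)%N ->
  cantor_stage j a L `<=` cantor_stage i a L.
Proof.
move=> L0 /subnK <-; elim: (j - i)%N => [//|k IH] x; rewrite addSn.
by move=> /(cantor_stageS L0)/IH.
Qed.

Lemma measurable_cantor_stage (R : realType) j (a L : R) :
  measurable (cantor_stage j a L : set (measurableTypeR R)).
Proof. by apply: open_measurable; exact: cantor_stage_open. Qed.

(** One more stage replaces an interval by two quarters of it, so the bound halves. *)
Lemma lebesgue_measure_cantor_stage (R : realType) j (a L : R) : 0 < L ->
  (lebesgue_measure (cantor_stage j a L) <= (L / (2 ^ j)%:R)%:E)%E.
Proof.
elim: j a L => [|j IH] a L L0.
  rewrite /= lebesgue_measure_itv/= lte_fin ltrDl L0 -EFinD lee_fin expn0.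
  by lra.
have L4 : 0 < L / 4 by lra.
apply: (@le_trans _ _ (lebesgue_measure (cantor_stage j a (L / 4)) +
    lebesgue_measure (cantor_stage j (a + L * 3 / 4) (L / 4)))%E).
  by apply: measureU2; exact: measurable_cantor_stage.
apply: (le_trans (leeD (IH _ _ L4) (IH _ _ L4))).
rewrite -EFinD lee_fin expnS natrM invfM.
by set t := ((2 ^ j)%:R)^-1; lra.
Qed.

(** * Pairs of nearby gaps, and their effect on density *)

Definition between_gaps (R : realType) (K : set R) (M x : R) : Prop :=
  exists l b c : R, [/\ 0 < l < M, b <= x <= c, c <= b + 2 * l,
    K `&` `]b - l, b[ = set0 & K `&` `]c, c + l[ = set0].

(** The gaps around [x] also serve [y], with [e = l]: a point of [K] within [l] of [x] that left
    [[b, c]] would fall into a gap. This is the relative openness that Baire's theorem asks for. *)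
Lemma between_gaps_nbhs (R : realType) (K : set R) (M x : R) :
  between_gaps K M x ->
  exists2 e, 0 < e & forall y, K y -> `|y - x| < e -> between_gaps K M y.
Proof.
move=> [l [b [c [/andP[l0 lM] /andP[bx xc] cb Kb Kc]]]]; exists l => // y Ky.
rewrite ltr_norml => /andP[? ?]; exists l, b, c; split => //; first by rewrite l0.
apply/andP; split; rewrite leNgt; apply/negP => ?.
  suff : (K `&` `]b - l, b[) y by rewrite Kb.
  by split => //=; rewrite in_itv/=; apply/andP; split; lra.
suff : (K `&` `]c, c + l[) y by rewrite Kc.
by split => //=; rewrite in_itv/=; apply/andP; split; lra.
Qed.

(* The two outer quarters carry stage [j]. If [K] avoids both of them, then they
   are gaps of [K] whose distance is only twice their length. *)
Lemma cantor_stage_or_between_gaps (R : realType) (K : set R) (M : R) j (a L x : R) :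
  0 < L <= M -> K x -> a < x < a + L ->
  exists y, [/\ K y, a < y < a + L & cantor_stage j a L y \/ between_gaps K M y].
Proof.
elim: j a L x => [|j IH] a L x /andP[L0 LM] Kx xL.
  by exists x; split => //; left; rewrite /= in_itv.
have L4 : 0 < L / 4 <= M by apply/andP; split; lra.
have [[y [Ky yl]]|NL] := pselect (exists y, K y /\ a < y < a + L / 4).
  have [z [Kz /andP[az zL] Cz]] := IH _ _ _ L4 Ky yl.
  exists z; split=> //; first by apply/andP; split; lra.
  by case: Cz => ?; [left; left|right].
have [[y [Ky yr]]|NR] := pselect
    (exists y, K y /\ a + L * 3 / 4 < y < a + L * 3 / 4 + L / 4).
  have [z [Kz /andP[az zL] Cz]] := IH _ _ _ L4 Ky yr.
  exists z; split=> //; first by apply/andP; split; lra.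
  by case: Cz => ?; [left; right|right].
exists x; split=> //; right; case/andP: xL => ax xL.
exists (L / 4), (a + L / 4), (a + L * 3 / 4); split.
- by apply/andP; split; lra.
- apply/andP; split; rewrite leNgt; apply/negP => ?.
    by apply: NL; exists x; split=> //; apply/andP; split; lra.
  by apply: NR; exists x; split=> //; apply/andP; split; lra.
- by lra.
- rewrite -subset0 => y [Ky /=]; rewrite in_itv/= => /andP[? ?]; apply: NL.
  by exists y; split=> //; apply/andP; split; lra.
- rewrite -subset0 => y [Ky /=]; rewrite in_itv/= => /andP[? ?]; apply: NR.
  by exists y; split=> //; apply/andP; split; lra.
Qed.

Lemma measR_le_itv (R : realType) (A : set R) (u v w z : R) :
  measurable (A : set (measurableTypeR R)) ->
  u <= v -> w <= z -> A `<=` `[u, v] `|` `[w, z] ->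
  measR A <= (v - u) + (z - w).
Proof.
move=> mA uv wz sub.
have itvE (p q : R) : p <= q -> lebesgue_measure `[p, q] = (q - p)%:E.
  rewrite lebesgue_measure_itv/= lte_fin le_eqVlt => /predU1P[->|->//].
  by rewrite ltxx subrr.
have : (lebesgue_measure A <= ((v - u) + (z - w))%:E)%E.
  rewrite EFinD -!itvE//.
  apply: le_trans; last first.
    by apply: measureU2; exact: measurable_itv.
  apply: le_measure; rewrite ?inE//.
  by apply: measurableU; exact: measurable_itv.
(* [fine] is faithful on finite values only; the bound itself supplies finiteness. *)
move=> le; rewrite /measR -lee_fin fineK// ge0_fin_numE//.
exact: le_lt_trans le (ltry _).
Qed.

(** As [x - b] and [c - x] are at most [2 * l], each one-sided window of length [3 * l] at [x]
    contains a whole gap of length [l], and [K] fills at most [2 * l] of it. *)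
Lemma between_gaps_not_SOSD_at (R : realType) (K : set R) (x : R) : closed K ->
  (forall M, 0 < M -> between_gaps K M x) -> ~ SOSD_at K x.
Proof.
move=> cK gaps.
have mK : measurable (K : set (measurableTypeR R)) by exact: closed_measurable.
have /choice[l lP] : forall n : nat, exists l : R, [/\ 0 < l, l < n.+1%:R^-1,
    measR (K `&` `[x - 3 * l, x]) <= 2 * l &
    measR (K `&` `[x, x + 3 * l]) <= 2 * l].
  move=> n; have [|l [b [c [/andP[l0 lM] /andP[bx xc] cb Kb Kc]]]] := gaps n.+1%:R^-1.
    by rewrite invr_gt0 ltr0n.
  exists l; split=> //.
  - have -> : 2 * l = (b - l - (x - 3 * l)) + (x - b) by lra.
    apply: measR_le_itv; [|lra|lra|].
      by apply: measurableI => //; exact: measurable_itv.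
    move=> y [Ky] /=; rewrite !in_itv/= => /andP[? ?].
    have [?|?] := leP y (b - l); first by left; apply/andP; split; lra.
    have [?|?] := leP b y; first by right; apply/andP; split; lra.
    suff : (K `&` `]b - l, b[) y by rewrite Kb.
    by split=> //=; rewrite in_itv/=; apply/andP; split.
  - have -> : 2 * l = (c - x) + (x + 3 * l - (c + l)) by lra.
    apply: measR_le_itv; [|lra|lra|].
      by apply: measurableI => //; exact: measurable_itv.
    move=> y [Ky] /=; rewrite !in_itv/= => /andP[? ?].
    have [?|?] := leP y c; first by left; apply/andP; split; lra.
    have [?|?] := leP (c + l) y; first by right; apply/andP; split; lra.
    suff : (K `&` `]c, c + l[) y by rewrite Kc.
    by split=> //=; rewrite in_itv/=; apply/andP; split.
have r0 n : 0 < 3 * l n by have [? _ _ _] := lP n; lra.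
have r_cvg : 3 * l n @[n --> \oo] --> (0 : R).
  rewrite -[X in _ --> X](mulr0 3); apply: cvgMr.
  apply/cvgrPdist_lt => e e0; near=> n.
  have [l0 lt _ _] := lP n.
  rewrite sub0r normrN gtr0_norm//; apply: lt_trans lt _.
  by near: n; exact: (near_infty_natSinv_lt (PosNum e0)).
(* Any tolerance up to 1/3 works: both quotients are at most 2/3. *)
move=> /(_ _ r0 r_cvg)/cvgrPdist_lt /(_ (1 / 4)) [|N _ /(_ N)]; first by lra.
move=> /(_ (leqnn N)) /=; have [l0 _ ml mr] := lP N.
rewrite ltr_norml => /andP[_]; apply/negP; rewrite -leNgt.
suff : Num.max (measR (K `&` `[x - 3 * l N, x]) / (3 * l N))
    (measR (K `&` `[x, x + 3 * l N]) / (3 * l N)) <= 2 / 3 by lra.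
by rewrite ge_max; apply/andP; split; rewrite ler_pdivrMr; lra.
Unshelve. all: by end_near. Qed.

(** * Baire's theorem in a closed subset of the line *)

Lemma baire_closed (R : realType) (K : set R) (V : nat -> set R) :
  closed K -> K !=set0 ->
  (forall n x, K x -> V n x ->
     exists2 e, 0 < e & forall y, K y -> `|y - x| < e -> V n y) ->
  (forall n x e, K x -> 0 < e -> exists y, [/\ K y, `|y - x| < e & V n y]) ->
  exists2 x, K x & forall n, V n x.
Proof.
move=> cK [x0 Kx0] Vopen Vdense.
pose ok (p : R * R) := K p.1 /\ 0 < p.2.
(* A pair is a centre in [K] and a radius. [f] picks a closed ball inside the given one, of at most
   half the radius, whose points of [K] all lie in [V n]. *)
have /choice[f fP] : forall np : nat * (R * R), exists q : R * R,
    ok np.2 -> [/\ ok q, `|q.1 - np.2.1| + q.2 <= np.2.2, q.2 <= np.2.2 / 2 &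
      forall y, K y -> `|y - q.1| <= q.2 -> V np.1 y].
  move=> [n [x e]] /=; have [[/= Kx e0]|nok] := pselect (ok (x, e)); last first.
    by exists (x, e) => /nok.
  have [y [Ky yx Vy]] := Vdense n x e Kx e0.
  have [d d0 dV] := Vopen n y Ky Vy.
  (* The three bounds give, in turn: a closed ball inside the open one of radius [d], halving, and
     nesting. *)
  pose t := Num.min (d / 2) (Num.min (e / 2) (e - `|y - x|)).
  have t0 : 0 < t by rewrite !lt_min; apply/and3P; split; lra.
  have : t <= t by [].
  rewrite {2}/t !le_min => /and3P[td te tx].
  exists (y, t) => _ /=; split=> //; first by lra.
  by move=> z Kz zy; apply: dV => //; lra.
pose p := fix p n := if n is m.+1 then f (m, p m) else (x0, 1).
have okp n : ok (p n).
  elim: n => [|n IH]; first by split => /=.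
  by have [] := fP (n, p n) IH.
have step n : [/\ `|(p n.+1).1 - (p n).1| + (p n.+1).2 <= (p n).2,
    (p n.+1).2 <= (p n).2 / 2 &
    forall y, K y -> `|y - (p n.+1).1| <= (p n.+1).2 -> V n y].
  by have [] := fP (n, p n) (okp n).
have nest n k : `|(p (n + k)%N).1 - (p n).1| + (p (n + k)%N).2 <= (p n).2.
  elim: k => [|k IH]; first by rewrite addn0 subrr normr0 add0r.
  rewrite addnS; have [s _ _] := step (n + k)%N.
  have := ler_normD ((p (n + k).+1).1 - (p (n + k)%N).1)
    ((p (n + k)%N).1 - (p n).1).
  by rewrite addrA subrK; lra.
have small n : (p n).2 <= n.+1%:R^-1.
  have : (p n).2 <= (2 ^ n)%:R^-1.
    elim: n => [|n IH]; first by rewrite /= expn0 invr1.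
    have [_ s _] := step n; rewrite expnS natrM invfM.
    by move: IH s; set u := (2 ^ n)%:R^-1; lra.
  by move/le_trans; apply; rewrite lef_pV2 ?posrE ?ltr0n ?expn_gt0// ler_nat ltn_expl.
(* Every left endpoint is below every right endpoint, so the supremum of the left endpoints lies in
   all the balls. *)
have cross n m : (p n).1 - (p n).2 <= (p m).1 + (p m).2.
  have [nm|/ltnW mn] := leqP n m.
    have := nest n (m - n)%N; rewrite subnKC// => h.
    have := ler_norm (- ((p m).1 - (p n).1)); rewrite normrN.
    by have [_] := okp m; lra.
  have := nest m (n - m)%N; rewrite subnKC// => h.
  have := ler_norm ((p n).1 - (p m).1).
  by have [_] := okp n; lra.
pose s := sup (range (fun n => (p n).1 - (p n).2)).
have sp n : `|s - (p n).1| <= (p n).2.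
  rewrite ler_distl; apply/andP; split.
    apply: ub_le_sup; last by exists n.
    by exists ((p 0%N).1 + (p 0%N).2) => _ [k _ <-].
  by apply: ge_sup; [exists ((p 0%N).1 - (p 0%N).2), 0%N|move=> _ [k _ <-]].
have Ks : K s.
  apply: cK => U /nbhs_ballP[e /= e0 eU].
  have [n] := ltr_add_invr e0; rewrite add0r => ne.
  exists (p n).1; split; first by have [] := okp n.
  apply: eU; rewrite /ball/=; apply: le_lt_trans (sp n) _.
  exact: le_lt_trans (small n) ne.
by exists s => // n; have [_ _] := step n; exact.
Qed.

(** * The open sets W_n and their null intersection *)

(** The interval coded by [q] has length at most 1, so its stage [n + q.+1] has measure at most
    2^-(n+q+1); these sum to at most 2^-n. *)
Definition stage_union (R : realType) (n : nat) : set R :=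
  \bigcup_q (if unpickle q is Some (r, i) then
    cantor_stage (n + q.+1) (ratr r : R) i.+1%:R^-1 else set0).
Arguments stage_union : clear implicits.

Lemma stage_union_open (R : realType) n : open (stage_union R n).
Proof.
apply: bigcup_open => q _; case: unpickle => [[r i]|]; last exact: open0.
exact: cantor_stage_open.
Qed.

Lemma stage_union_antitone (R : realType) m n : (m <= n)%N ->
  stage_union R n `<=` stage_union R m.
Proof.
move=> mn x [q _]; case E : (unpickle q) => [[r i]|//] xC.
exists q => //; rewrite E; apply: cantor_stage_antitone xC.
  by rewrite invr_gt0 ltr0n.
by rewrite leq_add2r.
Qed.

Lemma lebesgue_measure_stage_union (R : realType) n :
  (lebesgue_measure (stage_union R n) <= ((2 ^ n)%:R^-1)%:E)%E.
Proof.
apply: (@le_trans _ _ (\sum_(0 <= q <oo) ((2 ^ n)%:R^-1 / (2 ^ q.+1)%:R)%:E)%E);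
  last by apply: epsilon_trick0; rewrite invr_ge0.
pose A q : set R := if unpickle q is Some (r, i) then
  cantor_stage (n + q.+1) (ratr r) i.+1%:R^-1 else set0.
apply: (@le_trans _ _ (\sum_(0 <= q <oo) lebesgue_measure (A q))%E).
  apply: measure_sigma_subadditive => //; last first.
    by apply: open_measurable; exact: stage_union_open.
  move=> q; rewrite /A; case: unpickle => [[r i]|]; last exact: measurable0.
  exact: measurable_cantor_stage.
apply: lee_nneseries => // q _; rewrite /A.
case: unpickle => [[r i]|]; last first.
  by rewrite measure0 lee_fin mulr_ge0// invr_ge0.
have i0 : 0 < i.+1%:R^-1 :> R by rewrite invr_gt0 ltr0n.
apply: le_trans (lebesgue_measure_cantor_stage _ _ i0) _.
rewrite lee_fin expnD natrM invfM ler_piMl ?invr_ge0//.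
by rewrite invf_le1 ?ler1n ?ltr0n.
Qed.

Lemma lebesgue_measure_bigcap_stage_union (R : realType) :
  lebesgue_measure (\bigcap_n stage_union R n) = 0%E.
Proof.
apply/eqP; rewrite eq_le measure_ge0 andbT; apply/lee_addgt0Pr => e e0.
rewrite add0e; have [n] := ltr_add_invr e0; rewrite add0r => ne.
apply: (@le_trans _ _ (lebesgue_measure (stage_union R n))).
  apply: le_measure; rewrite ?inE.
  - by apply: bigcapT_measurable => k; by apply: open_measurable; exact: stage_union_open.
  - by apply: open_measurable; exact: stage_union_open.
  - by move=> x; apply.
apply: le_trans (lebesgue_measure_stage_union R n) _; rewrite lee_fin.
apply: le_trans (ltW ne).
by rewrite lef_pV2 ?posrE ?ltr0n ?expn_gt0// ler_nat ltn_expl.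
Qed.

(** * Density of the complement of a null set *)

Lemma measR_conull_itv (R : realType) (N : set R) (a b : R) :
  measurable (N : set (measurableTypeR R)) -> lebesgue_measure N = 0%E ->
  a <= b -> measR (~` N `&` `[a, b]) = b - a.
Proof.
move=> mN N0 ab; rewrite /measR setIC -setDE.
have mI : measurable (`[a, b]%classic : set (measurableTypeR R)).
  exact: measurable_itv.
have mD : measurable (`[a, b]%classic `\` N : set (measurableTypeR R)).
  exact: measurableD.
have -> : lebesgue_measure (`[a, b] `\` N) = lebesgue_measure `[a, b].
  apply/eqP; rewrite eq_le; apply/andP; split.
    by apply: le_measure; rewrite ?inE => // x [].
  rewrite -[leRHS]adde0 -[in leRHS]N0.
  apply: (@le_trans _ _ (lebesgue_measure (`[a, b] `\` N `|` N))).
    apply: le_measure; rewrite ?inE => //; first exact: measurableU.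
    by move=> x xI; have [?|?] := pselect (N x); [right|left].
  exact: measureU2.
by rewrite lebesgue_measure_itv/= lte_fin; case: ltgtP ab => // -> _; rewrite subrr.
Qed.

Lemma SOSD_conull (R : realType) (N : set R) :
  measurable (N : set (measurableTypeR R)) -> lebesgue_measure N = 0%E ->
  SOSD (~` N).
Proof.
move=> mN N0 x _ r r0 _.
rewrite (_ : (fun n => _) = cst 1); first exact: cvg_cst.
apply/funext => n /=; have rn := r0 n.
rewrite !measR_conull_itv//; try lra.
rewrite opprB addrC subrK addrAC subrr add0r.
by rewrite divff ?gt_eqF// maxxx.
Qed.

(** * Density in K, and the conclusion *)

Lemma stage_union_or_between_gaps (R : realType) (K : set R) n (M x e : R) :
  0 < M -> K x -> 0 < e ->
  exists y, [/\ K y, `|y - x| < e & stage_union R n y \/ between_gaps K M y].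
Proof.
move=> M0 Kx e0.
have : 0 < Num.min M e by rewrite lt_min M0.
move=> /ltr_add_invr[i]; rewrite add0r lt_min; set L := _%:R^-1 => /andP[LM Le].
have L0 : 0 < L by rewrite invr_gt0 ltr0n.
(* A rational [r] in []x - L, x[] gives an interval []r, r + L[] of the family that contains [x]; as
   [L < e], it stays within [e] of [x]. *)
have /rat_in_itvoo[r] : x - L < x by lra.
rewrite in_itv/= => /andP[rx xr].
have L0M : 0 < L <= M by rewrite L0 ltW.
have xL : ratr r < x < ratr r + L by apply/andP; split; lra.
have [y [Ky /andP[ry yr] Cy]] :=
  cantor_stage_or_between_gaps (n + (pickle (r, i)).+1) L0M Kx xL.
exists y; split=> //; first by rewrite ltr_distl; apply/andP; split; lra.
case: Cy => Cy; [left|by right].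
exists (pickle (r, i)); first exact: I.
by rewrite pickleK; exact: Cy.
Qed.

Theorem theorem3p2 (R : realType) :
  exists F : set R,
    [/\ F !=set0, SOSD F, Fsigma F &
        ~ exists K : set R, [/\ K `<=` F, K !=set0, closed K & SOSD K]].
Proof.
have mW : measurable (\bigcap_n stage_union R n : set (measurableTypeR R)).
  by apply: bigcapT_measurable => n; by apply: open_measurable; exact: stage_union_open.
have W0 := lebesgue_measure_bigcap_stage_union R.
exists (~` \bigcap_n stage_union R n); split.
- apply/set0P/eqP => F0; have := measR_conull_itv mW W0 (@ler01 R).
  rewrite F0 set0I /measR measure0/= subr0 => /eqP.
  by rewrite eq_sym oner_eq0.
- exact: SOSD_conull.
- exists (fun n => ~` stage_union R n); last by rewrite setC_bigcap.
  by move=> n; apply: open_closedC; exact: stage_union_open.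
move=> [K [KF K0 cK SK]].
have [x Kx Vx] : exists2 x, K x & forall n : nat,
    stage_union R n x \/ between_gaps K n.+1%:R^-1 x.
  apply: (@baire_closed _ K (fun n => [set x |
    stage_union R n x \/ between_gaps K n.+1%:R^-1 x])) => //.
    move=> n x Kx [|/between_gaps_nbhs[e e0 he]]; last first.
      by exists e => // y Ky yx; right; exact: he.
    move=> /(@stage_union_open R n)/nbhs_ballP[e /= e0 he].
    by exists e => // y _ yx; left; apply: he; rewrite /ball/= distrC.
  move=> n x e; apply: stage_union_or_between_gaps.
  by rewrite invr_gt0 ltr0n.
apply: (between_gaps_not_SOSD_at cK _ (SK x Kx)) => M M0.
have [m Wm] : exists m, ~ stage_union R m x.
  by apply/existsNP => xW; apply: (KF x Kx) => n _; exact: xW.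
have [i] := ltr_add_invr M0; rewrite add0r => iM.
(* An index at least [m] excludes W_n, as these sets decrease; one at least [i] makes the gaps
   shorter than [M]. *)
have [Wn|[l [b [c [/andP[l0 lM] bc cb Kb Kc]]]]] := Vx (maxn m i).
  by case: Wm; apply: stage_union_antitone Wn; exact: leq_maxl.
exists l, b, c; split=> //; rewrite l0/=; apply: (lt_trans lM).
apply: le_lt_trans iM.
by rewrite lef_pV2 ?posrE ?ltr0n// ler_nat ltnS leq_maxr.
Qed.
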